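(* Let $G$ be a finite group and let $k$ be the height of $L(G)$. Then $\mathcal I(G)$ is $(k-1)$-partite.
   Context: For a finite group $G$, the inclusion graph of subgroups $\mathcal I(G)$ is the simple graph whose vertices are the proper subgroups of $G$, where ''proper'' means different from both the trivial subgroup and $G$ itself; two distinct vertices $H,K$ are adjacent if and only if $H\subset K$ or $K\subset H$. Graphs are understood to have a nonempty vertex set, so $G$ is assumed to have at least one subgroup different from $\{e\}$ and $G$. $L(G)$ is the subgroup lattice of $G$ (all subgroups, including $\{e\}$ and $G$), and its height is the length (number of strict inclusions) of a longest chain of subgroups from $G$ to $\{e\}$. A graph is $m$-partite if its vertex set can be partitioned into $m$ disjoint subsets such that every edge joins vertices in two different subsets. *)

(* Defs.v *)
From HB Require Import structures.
From mathcomp Require Import all_boot all_fingroup.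

Set Implicit Arguments.
Unset Strict Implicit.
Unset Printing Implicit Defensive.

Local Open Scope group_scope.

Record sgraph := SGraph {
  vertex :> finType;
  adj : rel vertex;
  adj_sym : symmetric adj;
  adj_irrefl : irreflexive adj }.

(* The blocks of a [partition] are pairwise disjoint and nonempty, so an
   m-partition has exactly m nonempty parts. *)
Definition partite (m : nat) (Gr : sgraph) : Prop :=
  exists P : {set {set Gr}},
    [/\ partition P [set: Gr], #|P| = m &
        forall x y : Gr, adj x y -> pblock P x != pblock P y].

Section SubgroupLattice.

Variables (gT : finGroupType) (G : {group gT}).

(* This differs from [H \proper G], which does not exclude the trivial group. *)
Definition proper_subgroup (H : {group gT}) : bool :=
  [&& H \subset G, H != 1%G & H != G].

Definition inclusion_vertex := {H : {group gT} | proper_subgroup H}.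

Definition inclusion_adj : rel inclusion_vertex := fun u v =>
  (u != v) && ((val u \subset val v) || (val v \subset val u)).

Lemma inclusion_adj_sym : symmetric inclusion_adj.
Proof. by move=> u v; rewrite /inclusion_adj eq_sym orbC. Qed.

Lemma inclusion_adj_irrefl : irreflexive inclusion_adj.
Proof. by move=> u; rewrite /inclusion_adj eqxx. Qed.

Definition inclusion_graph : sgraph :=
  SGraph inclusion_adj_sym inclusion_adj_irrefl.

(* [s] lists the members strictly below G of a chain from G down to 1, so
   [size s] is the number of strict inclusions in that chain. *)
Definition subgroup_chain (s : seq {group gT}) : bool :=
  path (fun H K : {group gT} => K \proper H) G s && (last G s == 1%G).

Definition has_chain_length (n : nat) : bool :=
  [exists s : n.-tuple {group gT}, subgroup_chain s].

Lemma ex_chain_length : exists n, has_chain_length n.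
Proof.
have [G1 | ntG] := eqVneq G 1%G.
  by exists 0; apply/existsP; exists [tuple]; rewrite /subgroup_chain /= G1.
exists 1%N; apply/existsP; exists [tuple 1%G]; rewrite /subgroup_chain /= eqxx.
by rewrite proper1G ntG.
Qed.

Lemma chain_length_le (n : nat) : has_chain_length n -> n <= #|G|.
Proof.
case/existsP=> s /andP[+ _]; rewrite -{2}(size_tuple s).
elim: (tval s) G => //= K r IHr H /andP[ltKH /IHr le_rK].
exact: leq_ltn_trans le_rK (proper_card ltKH).
Qed.

Definition subgroup_height : nat := ex_maxn ex_chain_length chain_length_le.

End SubgroupLattice.

(* Main.v *)
Require Import Defs.
From HB Require Import structures.
From mathcomp Require Import all_boot all_fingroup.

(** The parts are the level sets of [subgroup_height]. A chain of length n from
    K to 1 becomes, when K < H, a chain of length n + 1 from H to 1 by putting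
    K in front of it; hence the height is strictly increasing for strict
    inclusion ([subgroup_height_proper]), and adjacent vertices of the inclusion
    graph have different heights. Comparing with 1 and with G, the height of a
    vertex lies between 1 and k - 1.

    A partition has nonempty parts, so each of these k - 1 values must also be
    attained. The second term of a longest chain from H down to 1 has height
    exactly one less than that of H, so descending from G meets every height
    ([subgroup_height_surj]). *)

(** It is surjectivity of the colouring onto the [m] colours that makes the
    number of nonempty colour classes exactly [m]. *)
Lemma surjective_colouring_partite (Gr : sgraph) (m : nat) (c : Gr -> nat) :
    (forall x, c x < m) -> (forall i, i < m -> exists x, c x = i) ->
    (forall x y, adj x y -> c x != c y) ->
  partite m Gr.
Proof.
move=> c_lt c_surj c_proper.
pose cls (i : 'I_m) := [set x | c x == i].
have in_cls x : x \in cls (Ordinal (c_lt x)) by rewrite inE.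
have cls_inj : injective cls.
  move=> i j eq_ij; have [x cx] := c_surj i (ltn_ord i).
  have: x \in cls j by rewrite -eq_ij inE cx.
  by rewrite inE cx => /eqP/val_inj.
have cls_mem i : cls i \in [set cls i | i : 'I_m] by apply: imset_f.
have partP : partition [set cls i | i : 'I_m] [set: Gr].
  apply/and3P; split.
  - rewrite eqEsubset subsetT; apply/subsetP=> x _.
    by apply/bigcupP; exists (cls (Ordinal (c_lt x))).
  - apply/trivIsetP=> _ _ /imsetP[i _ ->] /imsetP[j _ ->] neq_ij.
    rewrite -setI_eq0; apply/eqP/setP=> x; rewrite !inE.
    apply: contraNF neq_ij => /andP[/eqP-> /eqP/val_inj ->].
    exact: eqxx.
  - apply/imsetP=> -[i _ /setP cls0]; have [x cx] := c_surj i (ltn_ord i).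
    by have := cls0 x; rewrite !inE cx eqxx.
have [_ tiP _] := and3P partP.
exists [set cls i | i : 'I_m]; split=> //.
  by rewrite card_imset // card_ord.
move=> x y /c_proper; apply: contraNneq.
rewrite !(def_pblock tiP (cls_mem _) (in_cls _)) => /cls_inj.
by case=> ->.
Qed.

Section SubgroupHeight.

Variable gT : finGroupType.
Implicit Types (G H K : {group gT}) (s : seq {group gT}).

Lemma subgroup_height_chain G :
  exists2 s, subgroup_chain G s & size s = subgroup_height G.
Proof.
rewrite /subgroup_height; case: ex_maxnP => n /existsP[s chain_s] _.
by exists s; rewrite ?size_tuple.
Qed.

Lemma subgroup_height_max G s :
  subgroup_chain G s -> size s <= subgroup_height G.
Proof.
move=> chain_s; rewrite /subgroup_height; case: ex_maxnP => n _; apply.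
by apply/existsP; exists (in_tuple s).
Qed.

Lemma subgroup_height_proper H K :
  K \proper H -> subgroup_height K < subgroup_height H.
Proof.
move=> ltKH; have [s chain_s <-] := subgroup_height_chain K.
have := @subgroup_height_max H (K :: s); apply.
by rewrite /subgroup_chain /= ltKH.
Qed.

Lemma subgroup_height1 : subgroup_height [1 gT]%G = 0.
Proof.
have [[|K s] + <- //] := subgroup_height_chain [1 gT]%G.
by rewrite /subgroup_chain /= properE (sub1G K) andbF.
Qed.

(** The second term of a longest chain of [H] starts a chain which is one
    shorter, so its height is at least [n]; strict monotonicity bounds it
    above. *)
Lemma subgroup_height_pred H n :
    subgroup_height H = n.+1 ->
  exists2 K : {group gT}, K \subset H & subgroup_height K = n.
Proof.
move=> hH; have [[|K s]] := subgroup_height_chain H; rewrite hH //.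
rewrite /subgroup_chain /= => /andP[/andP[ltKH path_s] last_s] [size_s].
exists K; first exact: proper_sub.
apply/eqP; rewrite eqn_leq -ltnS -hH subgroup_height_proper //=.
by rewrite -size_s subgroup_height_max // /subgroup_chain path_s.
Qed.

Lemma subgroup_height_surj H i :
    i <= subgroup_height H ->
  exists2 K : {group gT}, K \subset H & subgroup_height K = i.
Proof.
move: {-1}(subgroup_height H) (erefl (subgroup_height H)) => n.
elim: n H => [|n IHn] H hH; first by rewrite leqn0 => /eqP->; exists H.
rewrite leq_eqVlt => /predU1P[-> | le_in]; first by exists H.
have [K sKH hK] := subgroup_height_pred _ _ hH.
have [L sLK hL] := IHn K hK le_in.
by exists L => //; apply: subset_trans sKH.
Qed.

End SubgroupHeight.

Theorem theorem2p5 (gT : finGroupType) (G : {group gT})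
    (hG : exists H : {group gT}, proper_subgroup G H)
    (k : nat) (hk : k = subgroup_height G) :
  partite (k - 1) (inclusion_graph G).
Proof.
have properP (H K : {group gT}) : H \subset K -> H != K -> H \proper K.
  by move=> sHK neHK; rewrite properEneq sHK andbT.
have height_gt0 (u : inclusion_graph G) : 0 < subgroup_height (val u).
  have /and3P[_ ntu _] := valP u.
  by rewrite -(subgroup_height1 gT) subgroup_height_proper // proper1G.
have height_lt (u : inclusion_graph G) : subgroup_height (val u) < k.
  by have /and3P[sG _ neG] := valP u; rewrite hk subgroup_height_proper ?properP.
(* Colours start at 0 whereas heights of vertices start at 1. *)
apply: (@surjective_colouring_partite _ _
          (fun u : inclusion_graph G => (subgroup_height (val u)).-1)).
- by move=> u; rewrite subn1 -ltnS !prednK // (leq_trans _ (height_lt u)).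
- move=> i; rewrite ltn_subRL add1n => lt_ik.
  have [|K sKG hK] := @subgroup_height_surj _ G i.+1; first by rewrite -hk ltnW.
  have vK : proper_subgroup G K.
    apply/and3P; split=> //; apply/eqP=> eqK.
      by have := subgroup_height1 gT; rewrite -eqK hK.
    by rewrite hk -eqK hK ltnn in lt_ik.
  by exists (exist _ K vK : inclusion_graph G); rewrite /= hK.
move=> u v /andP[neq_uv sub_uv].
rewrite -eqSS !prednK //; case/orP: sub_uv => sub_uv.
  by rewrite ltn_eqF // subgroup_height_proper ?properP.
by rewrite gtn_eqF // subgroup_height_proper ?properP // eq_sym.
Qed.
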